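(* Let $K\ge 2$. (i) Let $M=\{\mu_{i,j}\}\in\mathcal{M}_{\mathrm{C}}$ be an arbitrary preference matrix, with arms indexed so that arm $1$ is the Condorcet winner of $M$. For any algorithm that is strongly consistent for the model $\mathcal{M}_{\mathrm{C}}$, when the algorithm is run on $M$, $$\liminf_{T\to\infty}\frac{\mathbb{E}[R(T)]}{\log T}\ \ge\ \sum_{i\in[K]\setminus\{1\}}\ \min_{j\in\mathcal{O}_i}\ \frac{\Delta_{1,i}+\Delta_{1,j}}{2\,d(\mu_{i,j},1/2)} .$$ (ii) Furthermore, the same inequality holds for any $M\in\mathcal{M}_{\mathrm{o}}$ (with arms indexed so that arm $1$ is the Condorcet winner) and any algorithm that is strongly consistent for $\mathcal{M}_{\mathrm{o}}$.
   Context: $K$-armed dueling bandit: $[K]=\{1,\dots,K\}$ is the set of arms. A preference matrix is $M=\{\mu_{i,j}\}\in[0,1]^{K\times K}$ with $\mu_{i,j}=1-\mu_{j,i}$ and $\mu_{i,i}=1/2$; $\mu_{i,j}$ is the probability that arm $i$ is preferred to arm $j$. At each round $t=1,\dots,T$ the algorithm, knowing only past selections and feedback (and possibly using internal randomness), selects a pair $(l(t),m(t))\in[K]^2$ ($l(t)=m(t)$ is allowed) and receives feedback distributed as $\mathrm{Bernoulli}(\mu_{l(t),m(t)})$, independent of the past given the selected pair (value $1$ means $l(t)$ is preferred to $m(t)$). An arm $i$ is the Condorcet winner of $M$ if $\mu_{i,j}>1/2$ for all $j\in[K]\setminus\{i\}$. $\mathcal{M}_{\mathrm{C}}$ is the set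 of all preference matrices that have a Condorcet winner (whichever arm it is). $\mathcal{M}_{\mathrm{o}}\subset\mathcal{M}_{\mathrm{C}}$ is the set of preference matrices for which the relation $i\prec j\Leftrightarrow\mu_{i,j}<1/2$ is a total order on $[K]$. $\Delta_{i,j}=\mu_{i,j}-1/2$. If $w$ is the Condorcet winner, the regret of a round in which the pair $(i,j)$ is selected is $r(t)=(\Delta_{w,i}+\Delta_{w,j})/2$, and $R(T)=\sum_{t=1}^T r(t)$; so for a matrix with Condorcet winner $1$, $r(t)=(\Delta_{1,i}+\Delta_{1,j})/2$. An algorithm is strongly consistent for a model $\mathcal{M}\subset\mathcal{M}_{\mathrm{C}}$ if $\mathbb{E}[R(T)]=o(T^a)$ as $T\to\infty$ for every $a>0$ and every $M\in\mathcal{M}$. $\mathcal{O}_i=\{j\in[K]:\mu_{i,j}<1/2\}$ is the set of superiors of arm $i$. $d(p,q)=p\log\frac pq+(1-p)\log\frac{1-p}{1-q}$ is the KL divergence between Bernoulli distributions with parameters $p$ and $q$ (with $0\log 0=0$). *)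

(* Defs.v *)
From HB Require Import structures.
From mathcomp Require Import all_boot all_order all_algebra.
From mathcomp Require Import all_classical all_reals all_analysis.

Set Implicit Arguments.
Unset Strict Implicit.
Unset Printing Implicit Defensive.

Import Order.TTheory GRing.Theory Num.Theory.
Import numFieldNormedType.Exports.

Local Open Scope classical_set_scope.
Local Open Scope ring_scope.

(* The entry [M i j] is the probability that arm [i] is preferred to arm [j]. *)
Definition preference_matrix (R : realType) (K : nat) (M : 'M[R]_K) : Prop :=
  [/\ forall i j, 0 <= M i j <= 1,
      forall i j, M i j = 1 - M j i
    & forall i, M i i = 2^-1].

Definition condorcet_winner (R : realType) (K : nat) (M : 'M[R]_K) (i : 'I_K) :
    Prop :=
  forall j, j != i -> 2^-1 < M i j.

Definition condorcet_model (R : realType) (K : nat) : set 'M[R]_K :=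
  [set M | preference_matrix M /\ exists i, condorcet_winner M i].

Definition prec (R : realType) (K : nat) (M : 'M[R]_K) : rel 'I_K :=
  fun i j => M i j < 2^-1.

Definition strict_total_order (T : eqType) (r : rel T) : Prop :=
  [/\ irreflexive r, transitive r & forall i j, i != j -> r i j || r j i].

(* For [0 < K] the greatest arm for [prec M] is then a Condorcet winner, so
   this is a subset of [condorcet_model]. *)
Definition order_model (R : realType) (K : nat) : set 'M[R]_K :=
  [set M | preference_matrix M /\ strict_total_order (prec M)].

Definition gap (R : realType) (K : nat) (M : 'M[R]_K) (i j : 'I_K) : R :=
  M i j - 2^-1.

Definition superiors (R : realType) (K : nat) (M : 'M[R]_K) (i : 'I_K) :
    {set 'I_K} :=
  [set j | M i j < 2^-1]%SET.

(* Only meaningful for [0 <= p <= 1] and [0 < q < 1]; the convention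
   [0 log 0 = 0] holds because the logarithm is multiplied by [0]. *)
Definition bernoulli_kl (R : realType) (p q : R) : R :=
  p * ln (p / q) + (1 - p) * ln ((1 - p) / (1 - q)).

(* A round is the pair of selected arms with the feedback; [true] means that
   the first arm of the pair is preferred. *)
Definition round (K : nat) : Type := ('I_K * 'I_K * bool)%type.

(* All the internal randomness is carried by a seed, drawn once from an
   arbitrary probability space and independent of the preferences; given the
   seed, the next pair is a function of the past rounds, oldest first. *)
Record algorithm (R : realType) (K : nat) := Algorithm {
  seed_display : measure_display ;
  seed : measurableType seed_display ;
  seed_law : probability seed R ;
  select : seed -> seq (round K) -> 'I_K * 'I_K ;
  measurable_select : forall (h : seq (round K)) (p : 'I_K * 'I_K),
    measurable [set u | select u h = p] }.

(* The seeds for which the algorithm makes exactly the selections recorded in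
   [h] when it receives the feedback recorded in [h]. *)
Definition seeds_selecting (R : realType) (K : nat) (A : algorithm R K)
    (T : nat) (h : T.-tuple (round K)) : set (seed A) :=
  [set u | forall t : 'I_T, select u (take t h) = (tnth h t).1].

Arguments seeds_selecting {R K} A {T} h _.

(* The probability that the first [T] rounds are [h]: given the seed and the
   past, the feedback on a selected pair [(i, j)] is Bernoulli of parameter
   [M i j], so the feedback factors do not depend on the seed. *)
Definition history_prob (R : realType) (K : nat) (M : 'M[R]_K)
    (A : algorithm R K) (T : nat) (h : T.-tuple (round K)) : R :=
  fine (seed_law A (seeds_selecting A h)) *
  \prod_(t < T)
    let: (i, j, x) := tnth h t in bernoulli_pmf (M i j) x.

Definition round_regret (R : realType) (K : nat) (M : 'M[R]_K) (w : 'I_K)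
    (p : 'I_K * 'I_K) : R :=
  (gap M w p.1 + gap M w p.2) / 2.

(* [w] is meant to be the Condorcet winner of [M]. *)
Definition expected_regret (R : realType) (K : nat) (M : 'M[R]_K) (w : 'I_K)
    (A : algorithm R K) (T : nat) : R :=
  \sum_(h : T.-tuple (round K))
    history_prob M A h * \sum_(t < T) round_regret M w (tnth h t).1.

Definition strongly_consistent (R : realType) (K : nat) (model : set 'M[R]_K)
    (A : algorithm R K) : Prop :=
  forall (M : 'M[R]_K) (w : 'I_K), model M -> condorcet_winner M w ->
  forall a : R, 0 < a ->
    (fun T => expected_regret M w A T : R^o)
      =o_\oo (fun T => T%:R `^ a : R^o).

(* The minimum is taken in the extended reals, where [+oo] is neutral; its
   range contains [w] as soon as [w] is the Condorcet winner and [i != w]. *)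
Definition regret_constant (R : realType) (K : nat) (M : 'M[R]_K) (w : 'I_K) :
    \bar R :=
  (\sum_(i < K | i != w)
     \big[Order.min/+oo]_(j in superiors M i)
       ((gap M w i + gap M w j) / (2 * bernoulli_kl (M i j) 2^-1))%:E)%E.

(* Main.v *)
(* Change of measure.  For an arm [i] other than the winner [w], raise to
   [1/2 + e] the preference of [i] over each arm that it does not already beat;
   [i] becomes the Condorcet winner and the new matrix stays in the model.  Strong
   consistency makes the fraction of rounds spent on [(w, w)] tend to [1] under
   the original matrix, and to [0] faster than [T^(a-1)] under the new one, so
   that the Kullback-Leibler divergence between the laws of the first [T] rounds
   is at least [(1 - o(1)) ln T].  By the chain rule this divergence is the
   expected sum of the divergences of the rounds, which vanish unless [i] is
   played against an arm it does not beat.  Weight the bound for [i] by its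
   summand [m i] of the regret constant and add up: in each round the weighted
   divergences total at most the regret of the round, up to an error that
   vanishes with [e] and is absorbed because every pair other than [(w, w)] has
   regret bounded away from [0]. *)
Require Import Defs.
From mathcomp Require Import all_boot all_order all_algebra.
From mathcomp Require Import all_classical all_reals all_analysis.
From mathcomp Require Import ring lra.

Set Implicit Arguments.
Unset Strict Implicit.
Unset Printing Implicit Defensive.

Import Order.TTheory GRing.Theory Num.Theory.
Import numFieldNormedType.Exports.

Local Open Scope classical_set_scope.
Local Open Scope ring_scope.

(** * Finite decompositions of events and of sums over histories *)

Lemma measure_split_fin d (S : measurableType d) (R : realType)
    (P : probability S R) (J : finType) (D : set S) (f : S -> J) :
  measurable D -> (forall j, measurable [set u | f u = j]) ->
  fine (P D) = \sum_j fine (P (D `&` [set u | f u = j])).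
Proof.
move=> mD mf.
have mDf j : measurable (D `&` [set u | f u = j]) by apply: measurableI.
have -> : P D = (\sum_j P (D `&` [set u | f u = j]))%E.
  rewrite fsbig_seq ?index_enum_uniq//.
  rewrite -(measure_fin_bigcup P (F := fun j => D `&` [set u | f u = j]))//.
    congr (P _); apply/seteqP; split=> [u Du|u [j _ []//]].
    by exists (f u) => //=; rewrite mem_index_enum.
  apply/trivIsetP => i j _ _ /eqP ij; apply/seteqP; split=> // u /=.
  by case=> -[_ ->] [].
have Pfin j : true -> P (D `&` [set u | f u = j]) \is a fin_num.
  by move=> _; exact: fin_num_measure.
by apply: EFin_inj; rewrite -EFin_sum_fine.
Qed.

Lemma big_tuple_rcons (R : nmodType) (X : finType) (T : nat)
    (F : T.+1.-tuple X -> R) :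
  \sum_h F h = \sum_(h : T.-tuple X) \sum_x F (rcons_tuple h x).
Proof.
rewrite pair_big (reindex (fun q : T.-tuple X * X => rcons_tuple q.1 q.2))//=.
exists (fun h : T.+1.-tuple X =>
  (belast_tuple (thead h) (behead_tuple h), last (thead h) (behead h))).
- move=> [h x] _ /=; congr pair; last first.
    rewrite -[last _ _]/(last x (thead _ :: _)) /thead (tnth_nth x).
    by case: h => -[|y s] hs /=; rewrite ?last_rcons.
  apply: val_inj => /=; rewrite /thead (tnth_nth x)/=.
  by case: h => -[|y s] hs //=; rewrite belast_rcons.
- move=> h _; apply: val_inj => /=.
  by rewrite -lastI; case/tupleP: h => x t; rewrite theadE.
Qed.

(** * Laws of histories and expectations under them *)

Section Histories.
Context {R : realType} {K : nat}.
Implicit Types (M : 'M[R]_K) (A : algorithm R K) (T : nat).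

Lemma measurable_seeds_selecting A T (h : T.-tuple (round K)) :
  measurable (seeds_selecting A h).
Proof.
rewrite (_ : seeds_selecting A h =
  \bigcap_(t in [set: 'I_T]) [set u | select u (take t h) = (tnth h t).1]).
  by apply: fin_bigcap_measurable => // t _; exact: measurable_select.
by apply/seteqP; split=> u /= H t; [move=> _|]; exact: H.
Qed.

Lemma seeds_selecting_rcons A T (h : T.-tuple (round K)) (r : round K) :
  seeds_selecting A (rcons_tuple h r) =
  seeds_selecting A h `&` [set u | select u h = r.1].
Proof.
have tk (t : 'I_T) : take t (rcons h r) = take t h.
  by rewrite -cats1 takel_cat// size_tuple ltnW.
have tkT : take T (rcons h r) = h.
  by rewrite -cats1 -[X in take X](size_tuple h) take_size_cat.
have nth_h (t : 'I_T) : nth r (rcons h r) t = tnth h t.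
  by rewrite nth_rcons size_tuple ltn_ord (tnth_nth r).
have nth_T : nth r (rcons h r) T = r.
  by rewrite nth_rcons size_tuple ltnn eqxx.
apply/seteqP; split=> u /=.
- move=> H; split=> [t|].
    by have := H (widen_ord (leqnSn T) t); rewrite (tnth_nth r)/= tk nth_h.
  by have := H ord_max; rewrite (tnth_nth r)/= tkT nth_T.
- move=> [H Hr] t; rewrite (tnth_nth r)/=.
  have := ltn_ord t; rewrite ltnS leq_eqVlt => /predU1P[->|tT].
    by rewrite tkT nth_T.
  by have := H (Ordinal tT); rewrite -nth_h -tk.
Qed.

Definition seed_prob A T (h : T.-tuple (round K)) : R :=
  fine (seed_law A (seeds_selecting A h)).

Definition round_lik M (r : round K) : R := bernoulli_pmf (M r.1.1 r.1.2) r.2.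

Definition history_lik M (h : seq (round K)) : R := \prod_(r <- h) round_lik M r.

(** The matrix enters only through the second factor, so the seed factor cancels when two matrices
    are compared under the same algorithm. *)
Lemma history_probE M A T (h : T.-tuple (round K)) :
  history_prob M A h = seed_prob A h * history_lik M h.
Proof.
rewrite /history_prob /history_lik big_tuple; congr (_ * _).
by apply: eq_bigr => t _; rewrite /round_lik; case: (tnth h t) => -[].
Qed.

Lemma seed_prob_ge0 A T (h : T.-tuple (round K)) : 0 <= seed_prob A h.
Proof. exact: fine_ge0. Qed.

Lemma round_lik_ge0 M (r : round K) : preference_matrix M -> 0 <= round_lik M r.
Proof.
case=> M01 _ _; rewrite /round_lik/= /bernoulli_pmf.
by have /andP[M0 M1] := M01 r.1.1 r.1.2; case: ifP; rewrite ?subr_ge0.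
Qed.

Lemma history_lik_ge0 M (h : seq (round K)) :
  preference_matrix M -> 0 <= history_lik M h.
Proof. by move=> HM; apply: prodr_ge0 => r _; exact: round_lik_ge0. Qed.

(** [F] acts on sequences rather than tuples, so that one statistic serves all horizons and
    inductions on [T] can extend a history. *)
Definition expectation_hist M A T (F : seq (round K) -> R) : R :=
  \sum_(h : T.-tuple (round K)) history_prob M A h * F h.

(** The feedback [true] is an arbitrary choice: the selections constrain the seed only through
    feedback received before them, never through the last one. *)
Lemma seed_prob_rcons A T (h : T.-tuple (round K)) :
  \sum_(p : 'I_K * 'I_K) seed_prob A (rcons_tuple h (p, true)) = seed_prob A h.
Proof.
rewrite [RHS](measure_split_fin (seed_law A) (f := fun u => select u h))//.
- by apply: eq_bigr => p _; rewrite /seed_prob seeds_selecting_rcons.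
- exact: measurable_seeds_selecting.
- exact: measurable_select.
Qed.

Lemma expectation_histS M A T (F : seq (round K) -> R) :
  expectation_hist M A T.+1 F =
  \sum_(h : T.-tuple (round K)) \sum_(p : 'I_K * 'I_K)
    seed_prob A (rcons_tuple h (p, true)) * history_lik M h *
    (M p.1 p.2 * F (rcons h (p, true)) +
     (1 - M p.1 p.2) * F (rcons h (p, false))).
Proof.
rewrite /expectation_hist big_tuple_rcons; apply: eq_bigr => h _.
rewrite (eq_bigr (fun r : round K => (fun p x =>
  history_prob M A (rcons_tuple h (p, x)) * F (rcons h (p, x))) r.1 r.2)).
  rewrite -(pair_bigA _ (fun p x =>
    history_prob M A (rcons_tuple h (p, x)) * F (rcons h (p, x))))/=.
  apply: eq_bigr => p _; rewrite big_bool !history_probE/=.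
  rewrite /history_lik -!cats1 !big_cat !big_seq1 /seed_prob.
  rewrite !seeds_selecting_rcons.
  by rewrite /round_lik/=; ring.
by move=> [].
Qed.

Lemma eq_expectation_hist M A T (F G : seq (round K) -> R) :
  F =1 G -> expectation_hist M A T F = expectation_hist M A T G.
Proof. by move=> FG; apply: eq_bigr => h _; rewrite FG. Qed.

Lemma expectation_hist1 M A T : expectation_hist M A T (fun=> 1) = 1.
Proof.
elim: T => [|T IH].
  rewrite /expectation_hist (big_pred1 [tuple]) => [|h]; last first.
    by apply/esym/eqP; exact: tuple0.
  rewrite history_probE /history_lik big_nil /seed_prob !mulr1.
  rewrite (_ : seeds_selecting _ _ = setT) ?probability_setT//.
  by apply/seteqP; split=> // u _ [].
rewrite expectation_histS -[RHS]IH; apply: eq_bigr => h _.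
rewrite history_probE -[in RHS]seed_prob_rcons !mulr_suml; apply: eq_bigr => p _.
by rewrite !mulr1 subrKC mulr1.
Qed.

Lemma expectation_histD M A T (F G : seq (round K) -> R) :
  expectation_hist M A T (fun h => F h + G h) =
  expectation_hist M A T F + expectation_hist M A T G.
Proof.
by rewrite -big_split; apply: eq_bigr => h _; rewrite mulrDr.
Qed.

Lemma expectation_histZ M A T c (F : seq (round K) -> R) :
  expectation_hist M A T (fun h => c * F h) = c * expectation_hist M A T F.
Proof.
by rewrite /expectation_hist mulr_sumr; apply: eq_bigr => h _; rewrite mulrCA.
Qed.

Lemma expectation_hist_cst M A T c : expectation_hist M A T (fun=> c) = c.
Proof.
by rewrite -[RHS]mulr1 -(expectation_hist1 M A T) -expectation_histZ;
  apply: eq_expectation_hist => h; rewrite mulr1.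
Qed.

Lemma expectation_hist_sum M A T (I : finType) (P : pred I)
    (F : I -> seq (round K) -> R) :
  expectation_hist M A T (fun h => \sum_(i | P i) F i h) =
  \sum_(i | P i) expectation_hist M A T (F i).
Proof.
by rewrite exchange_big; apply: eq_bigr => h _; rewrite mulr_sumr.
Qed.

Lemma le_expectation_hist M A T (F G : seq (round K) -> R) :
  preference_matrix M -> (forall h, size h = T -> F h <= G h) ->
  expectation_hist M A T F <= expectation_hist M A T G.
Proof.
move=> HM FG; apply: ler_sum => h _; apply: ler_wpM2l; last first.
  by apply: FG; rewrite size_tuple.
by rewrite history_probE mulr_ge0 ?seed_prob_ge0 ?history_lik_ge0.
Qed.

(* The centred process [\sum_(r <- h) (s r - sbar r.1)] is a martingale. *)
Lemma expectation_hist_compensator M A T (s : round K -> R)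
    (sbar : 'I_K * 'I_K -> R) :
  (forall p, M p.1 p.2 * s (p, true) + (1 - M p.1 p.2) * s (p, false) = sbar p) ->
  expectation_hist M A T (fun h => \sum_(r <- h) s r) =
  expectation_hist M A T (fun h => \sum_(r <- h) sbar r.1).
Proof.
move=> sE; apply/eqP; rewrite -subr_eq0; apply/eqP.
rewrite -mulN1r -expectation_histZ -expectation_histD.
elim: T => [|T IH].
  rewrite /expectation_hist big1// => h _.
  by rewrite tuple0/= !big_nil mulr0 addr0 mulr0.
rewrite expectation_histS -[RHS]IH; apply: eq_bigr => h _.
rewrite history_probE -[in RHS]seed_prob_rcons !mulr_suml; apply: eq_bigr => p _.
congr (_ * _); rewrite -!cats1 !big_cat !big_seq1/= -sE.
by ring.
Qed.

Lemma expected_regretE M w A T :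
  expected_regret M w A T =
  expectation_hist M A T (fun h => \sum_(r <- h) round_regret M w r.1).
Proof. by apply: eq_bigr => h _; rewrite big_tuple. Qed.

End Histories.

(** * Bernoulli divergences and a convexity bound *)

Section BernoulliKL.
Context {R : realType}.
Implicit Types p q e : R.

Lemma bernoulli_klE p q : 0 <= p <= 1 -> 0 < q < 1 ->
  bernoulli_kl p q =
  (p * ln p + (1 - p) * ln (1 - p)) - (p * ln q + (1 - p) * ln (1 - q)).
Proof.
have mul_ln_div (x y : R) :
    0 <= x -> 0 < y -> x * ln (x / y) = x * ln x - x * ln y.
  rewrite le0r => /predU1P[->|x0] y0; first by rewrite !mul0r subrr.
  by rewrite ln_div ?posrE// mulrBr.
move=> /andP[p0 p1] /andP[q0 q1].
by rewrite /bernoulli_kl !mul_ln_div ?subr_ge0 ?subr_gt0//; ring.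
Qed.

Lemma bernoulli_kl_refl p : bernoulli_kl p p = 0.
Proof.
have mul_ln_div1 (x : R) : x * ln (x / x) = 0.
  by have [->|x0] := eqVneq x 0; rewrite ?mul0r// divff// ln1 mulr0.
by rewrite /bernoulli_kl !mul_ln_div1 addr0.
Qed.

Lemma bernoulli_kl_flip p q : bernoulli_kl (1 - p) (1 - q) = bernoulli_kl p q.
Proof. by rewrite /bernoulli_kl !subKr addrC. Qed.

Lemma bernoulli_kl_ge0 p q : 0 <= p <= 1 -> 0 < q < 1 -> 0 <= bernoulli_kl p q.
Proof.
(* This follows from [ln z <= z - 1] at [z = y / x]. Applied to [p, q] and to [1 - p, 1 - q], the
   two left-hand sides cancel. *)
have mul_ln_div_ge (x y : R) : 0 <= x -> 0 < y -> x - y <= x * ln (x / y).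
  rewrite le0r => /predU1P[->|x0] y0; first by rewrite mul0r sub0r oppr_le0 ltW.
  have xy0 : 0 < y / x by rewrite divr_gt0.
  have : ln (y / x) <= y / x - 1.
    by have := @le_ln1Dx _ (y / x - 1); rewrite subrKC; apply; lra.
  rewrite -(ler_pM2l x0) mulrBr mulr1 mulrCA divff ?gt_eqF// mulr1.
  by rewrite -[x / y]invf_div lnV ?posrE// mulrN => ?; lra.
move=> /andP[p0 p1] /andP[q0 q1]; rewrite /bernoulli_kl.
have := mul_ln_div_ge p q p0 q0.
have := mul_ln_div_ge (1 - p) (1 - q); rewrite subr_ge0 subr_gt0 => /(_ p1 q1).
by move=> ? ?; lra.
Qed.

(** Both [q] and [1 - q] are at least [(1 - 2 * e) / 2], so each logarithm loses at most
    [- ln (1 - 2 * e)] against its value at [1/2], and the weights [p] and [1 - p] add up to [1]. *)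
Lemma bernoulli_kl_half_perturb p q e : 0 <= p <= 1 -> 0 < e < 2^-1 ->
  2^-1 - e <= q <= 2^-1 + e ->
  bernoulli_kl p q <= bernoulli_kl p 2^-1 - ln (1 - 2 * e).
Proof.
move=> p01 /andP[e0 e1] /andP[qe1 qe2]; rewrite !bernoulli_klE//; try lra.
have le_ln (x : R) : 2^-1 - e <= x -> ln 2^-1 + ln (1 - 2 * e) <= ln x.
  move=> ex; rewrite -lnM ?posrE; [|lra..].
  by rewrite ler_ln ?posrE; lra.
have -> : 1 - 2^-1 = 2^-1 :> R by lra.
have /andP[p0 p1] := p01.
have := ler_wpM2l p0 (le_ln q qe1).
have p1' : 0 <= 1 - p by lra.
have := ler_wpM2l p1' (le_ln (1 - q) ltac:(lra)).
by move=> ? ?; lra.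
Qed.

End BernoulliKL.

(** By convexity the exponential lies below its chord between [0] and [l]; the proof combines the
    tangent at [l * y], evaluated at both ends. This bounds an exponential moment by a mean. *)
Lemma expR_chord {R : realType} (l y : R) : 0 <= y <= 1 ->
  expR (l * y) <= 1 + y * (expR l - 1).
Proof.
move=> /andP[y0 y1]; have y1' : 0 <= 1 - y by lra.
have tangent z : expR (l * y) * (1 + (z - l * y)) <= expR z.
  have -> : expR z = expR (l * y) * expR (z - l * y).
    by rewrite -expRD addrC subrK.
  by rewrite ler_pM2l ?expR_gt0// expR_ge1Dx.
have := ler_wpM2l y0 (tangent l); have := ler_wpM2l y1' (tangent 0).
by rewrite expR0; set x := expR _; set z := expR _ => ? ?; nra.
Qed.

(** * Likelihood ratios and change of measure *)

Section ChangeOfMeasure.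
Context {R : realType} {K : nat}.
Implicit Types (M : 'M[R]_K) (A : algorithm R K) (T : nat).

(** Its mean under [M] given the selected pair is the Bernoulli divergence of that pair, which
    yields the chain rule. *)
Definition round_llr M M' (r : round K) : R :=
  ln (round_lik M r / round_lik M' r).

(** A hypothesis on zero entries also covers the entries equal to [1], by the symmetry
    [M i j = 1 - M j i]. *)
Lemma round_lik_abs_cont M M' (r : round K) :
  preference_matrix M -> preference_matrix M' ->
  (forall i j, M' i j = 0 -> M i j = 0) ->
  0 < round_lik M r -> 0 < round_lik M' r.
Proof.
move=> HM HM' ac; rewrite !lt_neqAle !round_lik_ge0// !andbT ![0 == _]eq_sym.
apply: contraNN => /eqP; rewrite /round_lik/bernoulli_pmf.
case: HM HM' => _ Mc _ [_ Mc' _]; case: ifP => _; first by move/ac ->.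
by rewrite -Mc' -Mc => /ac ->.
Qed.

Lemma history_lik_llr M M' (h : seq (round K)) :
  preference_matrix M -> preference_matrix M' ->
  (forall i j, M' i j = 0 -> M i j = 0) ->
  0 < history_lik M h ->
  history_lik M h = history_lik M' h * expR (\sum_(r <- h) round_llr M M' r).
Proof.
move=> HM HM' ac; elim: h => [|r h IH].
  by rewrite /history_lik !big_nil expR0 mulr1.
rewrite /history_lik !big_cons -!/(history_lik _ _) => Mrh0.
have Mr0 : 0 < round_lik M r.
  rewrite lt_neqAle round_lik_ge0// andbT; apply: contraTN Mrh0 => /eqP <-.
  by rewrite mul0r ltxx.
have Mr0' := round_lik_abs_cont HM HM' ac Mr0.
rewrite IH; last by rewrite -(pmulr_rgt0 _ Mr0).
rewrite expRD {2}/round_llr lnK ?posrE ?divr_gt0//.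
by field; rewrite gt_eqF.
Qed.

(* The Donsker-Varadhan bound [KL(P, Q) >= E_P Y - ln (E_Q (expR Y))] for the
   laws of the histories, which uses only [1 + z <= expR z]. *)
Lemma change_of_measure M M' A T (Y : seq (round K) -> R) :
  preference_matrix M -> preference_matrix M' ->
  (forall i j, M' i j = 0 -> M i j = 0) ->
  expectation_hist M' A T (expR \o Y) <= 2 ->
  expectation_hist M A T Y - ln 2 <=
  expectation_hist M A T
    (fun h => \sum_(r <- h) bernoulli_kl (M r.1.1 r.1.2) (M' r.1.1 r.1.2)).
Proof.
move=> HM HM' ac HY.
rewrite -(@expectation_hist_compensator _ _ _ _ _ (round_llr M M')
  (fun p => bernoulli_kl (M p.1 p.2) (M' p.1 p.2)))//.
have : expectation_hist M A T
    (fun h => Y h - ln 2 + -1 * \sum_(r <- h) round_llr M M' r + 1) <=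
    2^-1 * expectation_hist M' A T (expR \o Y).
  rewrite -expectation_histZ; apply: ler_sum => h _.
  rewrite !history_probE -!mulrA; apply: ler_wpM2l; first exact: seed_prob_ge0.
  rewrite mulN1r; set z := Y h - _ - _.
  (* Histories impossible under [M] are treated apart, since the logarithm of their likelihood ratio
     is meaningless. *)
  have := history_lik_ge0 h HM; rewrite le0r => /predU1P[->|Mh0].
    by rewrite mul0r !mulr_ge0 ?invr_ge0 ?expR_ge0 ?history_lik_ge0.
  have -> : history_lik M' h * (2^-1 * (expR \o Y) h) = history_lik M h * expR z.
    rewrite (history_lik_llr HM HM' ac Mh0) -mulrA -expRD subrKC.
    by rewrite expRD expRN lnK ?posrE// [2^-1 * _]mulrC.
  by rewrite ler_pM2l// addrC expR_ge1Dx.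
rewrite !expectation_histD !expectation_hist_cst.
by rewrite expectation_histZ => ?; lra.
Qed.

End ChangeOfMeasure.

(** * Alternative matrices in which a chosen arm wins *)

Section Promotion.
Context {R : realType} {K : nat}.
Implicit Types (M : 'M[R]_K) (A : algorithm R K).

(* Ties of [i] are also broken in its favour, since [i] must be a strict
   winner. *)
Definition promote M (i : 'I_K) (e : R) : 'M[R]_K :=
  \matrix_(a, b)
    if [&& a == i, b != i & M i b <= 2^-1] then 2^-1 + e
    else if [&& b == i, a != i & M i a <= 2^-1] then 2^-1 - e
    else M a b.

Lemma promote_preference M i e : preference_matrix M -> 0 < e < 2^-1 ->
  preference_matrix (promote M i e).
Proof.
move=> [M01 Mc Mh] /andP[e0 e1]; split=> [a b|a b|a].
- rewrite mxE; case: ifP => _; first lra.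
  by case: ifP => _; [lra|exact: M01].
- rewrite !mxE; case: ifP => [/and3P[ai bi Mib]|_].
    by rewrite ai (negbTE bi)/=; lra.
  by case: ifP => _; [lra|exact: Mc].
- by rewrite mxE; case: eqVneq => //= _; exact: Mh.
Qed.

Lemma promote_winner M i e : 0 < e -> condorcet_winner (promote M i e) i.
Proof.
move=> e0 j ji; rewrite mxE eqxx ji/=; case: ifPn => [_|]; first lra.
by rewrite -ltNge (negbTE ji).
Qed.

Lemma promote_abs_cont M i e a b : 0 < e < 2^-1 ->
  promote M i e a b = 0 -> M a b = 0.
Proof.
move=> /andP[e0 e1]; rewrite mxE; case: ifP => _; first lra.
by case: ifP => _ //; lra.
Qed.

(** Promotion moves [i] to the top of the order and leaves the other arms in their relative
    order. *)
Lemma promote_order M i e : order_model M -> 0 < e < 2^-1 ->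
  order_model (promote M i e).
Proof.
move=> [HM [irr tr tot]] e01; split; first exact: promote_preference.
have /andP[e0 e1] := e01; have [_ Mc Mh] := HM.
have promote_prec a b :
    prec (promote M i e) a b = (a != i) && ((b == i) || prec M a b).
  rewrite /prec mxE; have [->|ai] /= := eqVneq a i.
    have [->|bi] /= := eqVneq b i; first by rewrite Mh ltxx.
    by rewrite leNgt; case: (ltP _ (M i b)) => /= ?; lra.
  have [->|bi] //= := eqVneq b i.
  case: (leP (M i a)) => [_|]; first lra.
  by rewrite (Mc a); lra.
split.
- by move=> a; rewrite promote_prec irr; case: eqP.
- move=> b a c; rewrite !promote_prec => /andP[ai ab] /andP[bi bc].
  rewrite ai/=; move: ab; rewrite (negbTE bi)/= => ab.
  by case/orP: bc => [->//|bc]; rewrite (tr _ _ _ ab bc) orbT.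
- move=> a b ab; rewrite !promote_prec.
  have [ai|ai] /= := eqVneq a i; first by rewrite -ai eq_sym ab.
  by have [bi|bi] //= := eqVneq b i; exact: tot.
Qed.

Lemma promote_other M i e a b : a != i -> b != i -> promote M i e a b = M a b.
Proof. by move=> ai bi; rewrite mxE (negbTE ai) (negbTE bi). Qed.

Lemma gap_ge0 M w i : preference_matrix M -> condorcet_winner M w ->
  0 <= gap M w i.
Proof.
move=> [_ _ Mh] Mw; rewrite /gap subr_ge0.
by have [->|/Mw/ltW//] := eqVneq i w; rewrite Mh.
Qed.

Lemma round_regret_ge0 M w p : preference_matrix M -> condorcet_winner M w ->
  0 <= round_regret M w p.
Proof. by move=> HM Mw; apply: divr_ge0; [apply: addr_ge0; exact: gap_ge0|]. Qed.

Lemma round_regret_lb M w : preference_matrix M -> condorcet_winner M w ->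
  exists2 c : R, 0 < c & forall p, p != (w, w) -> c <= round_regret M w p.
Proof.
(* The minimum runs over finitely many positive regrets; the starting value [1] only has to be
   positive. *)
move=> HM Mw; exists (\big[Order.min/1]_(p | p != (w, w)) round_regret M w p).
  rewrite lt_bigmin// => -[i j] /= ij; rewrite divr_gt0//.
  have gap_gt0 k : k != w -> 0 < gap M w k by move/Mw; rewrite /gap subr_gt0.
  have := gap_ge0 i HM Mw; have := gap_ge0 j HM Mw.
  move: ij; rewrite xpair_eqE negb_and => /orP[/gap_gt0|/gap_gt0]; lra.
by move=> p pw; exact: bigmin_le_cond.
Qed.

(* In a round on [(a, b)] only the worse arm of the pair has a divergence
   which does not vanish with [e]. *)
Lemma promote_kl_le_regret M w (m : 'I_K -> R) (e : R) p :
  preference_matrix M -> condorcet_winner M w -> 0 < e < 2^-1 ->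
  (forall i, 0 <= m i) ->
  (forall i j, M i j < 2^-1 ->
     m i * bernoulli_kl (M i j) 2^-1 <= round_regret M w (i, j)) ->
  \sum_(i | i != w) m i * bernoulli_kl (M p.1 p.2) (promote M i e p.1 p.2) <=
  round_regret M w p - ln (1 - 2 * e) * \sum_(i | i != w) m i.
Proof.
case: p => a b HM Mw e01 m0 mkl /=; have /andP[e0 e1] := e01.
have [M01 Mc Mh] := HM; have M10 i j : M i j <= 1 by case/andP: (M01 i j).
have rr0 := round_regret_ge0 (a, b) HM Mw.
have rrC : round_regret M w (b, a) = round_regret M w (a, b).
  by rewrite /round_regret/= addrC.
(* The worse arm of the pair. On a tie either choice would do, as the divergence from [1/2] is then
   [0]. *)
pose c := if M a b < 2^-1 then a else b.
have dl : 0 <= - ln (1 - 2 * e) by rewrite oppr_ge0 ln_le0//; lra.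
have half_kl : bernoulli_kl 2^-1 2^-1 = 0 :> R by exact: bernoulli_kl_refl.
have perturb i q : 2^-1 - e <= q <= 2^-1 + e ->
    m i * bernoulli_kl (M a b) q <=
    m i * - ln (1 - 2 * e) + m i * bernoulli_kl (M a b) 2^-1.
  by move=> ?; rewrite -mulrDr ler_wpM2l// addrC bernoulli_kl_half_perturb.
(* Every arm pays the perturbation error, but only [c] is charged the regret of the round. *)
have term i : m i * bernoulli_kl (M a b) (promote M i e a b) <=
    m i * - ln (1 - 2 * e) + (i == c)%:R * round_regret M w (a, b).
  rewrite mxE; case: ifPn => [/and3P[/eqP ai bi Mib]|_].
    apply: le_trans (perturb _ _ _) _; first lra.
    rewrite lerD2l; move: Mib; rewrite -ai le_eqVlt => /predU1P[->|Mab].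
      by rewrite half_kl mulr0 mulr_ge0.
    by rewrite /c Mab eqxx mul1r mkl.
  case: ifPn => [/and3P[/eqP bi ai Mia]|_].
    apply: le_trans (perturb _ _ _) _; first lra.
    rewrite lerD2l; move: Mia; rewrite -bi le_eqVlt => /predU1P[|Mba].
      rewrite (Mc a b) => ->; rewrite (_ : 1 - 2^-1 = 2^-1 :> R); last lra.
      by rewrite half_kl mulr0 mulr_ge0.
    rewrite /c ifF; last by rewrite (Mc a b); lra.
    rewrite eqxx mul1r -rrC (Mc a b) (_ : 2^-1 = 1 - 2^-1 :> R); last lra.
    by rewrite bernoulli_kl_flip mkl.
  rewrite bernoulli_kl_refl mulr0.
  by apply: addr_ge0; apply: mulr_ge0 => //; exact: ler0n.
apply: le_trans (ler_sum _ (fun i _ => term i)) _.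
rewrite big_split/= addrC -!mulr_suml mulrN [X in _ - X <= _]mulrC lerD2r.
rewrite -[leRHS]mul1r; apply: ler_wpM2r => //.
rewrite big_mkcond/= (bigD1 c)//= big1 => [|i ic]; last first.
  by rewrite (negbTE ic); case: ifP.
by rewrite addr0 eqxx; case: ifP.
Qed.

(** A round on [(w, w)] has no regret that could absorb a perturbation error, so its divergence has
    to vanish exactly. *)
Lemma promote_kl_winner M w i e : i != w ->
  bernoulli_kl (M w w) (promote M i e w w) = 0.
Proof. by move=> iw; rewrite promote_other 1?eq_sym// bernoulli_kl_refl. Qed.

End Promotion.

(** * Information bound at a fixed horizon *)

Section RegretLowerBound.
Context {R : realType} {K : nat}.
Implicit Types (M : 'M[R]_K) (A : algorithm R K) (T : nat).

(* The test statistic is the fraction of the rounds spent on [(w, w)]: it is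
   close to [1] under [M] and close to [0] under [promote M i e]. *)
Lemma information_lower_bound M (w i : 'I_K) A T (e c l : R) :
  preference_matrix M -> condorcet_winner M w -> i != w -> 0 < e < 2^-1 ->
  0 < c -> (forall p, p != (w, w) -> c <= round_regret M w p) ->
  (0 < T)%N -> 0 <= l ->
  expected_regret (promote M i e) i A T * expR l <= e * T%:R ->
  l * (1 - expected_regret M w A T / (c * T%:R)) - ln 2 <=
  expectation_hist M A T (fun h => \sum_(r <- h)
    bernoulli_kl (M r.1.1 r.1.2) (promote M i e r.1.1 r.1.2)).
Proof.
move=> HM Mw iw e01 c0 cP T0 l0 HT; have /andP[e0 e1] := e01.
have T0' : 0 < T%:R :> R by rewrite ltr0n.
set M' := promote M i e.
have HM' : preference_matrix M' by exact: promote_preference.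
have Mw' : condorcet_winner M' i by exact: promote_winner.
pose N (h : seq (round K)) : R := \sum_(r <- h) (r.1 == (w, w))%:R.
have N0 h : 0 <= N h by apply: sumr_ge0 => r _.
have size_N h : (size h)%:R - N h = \sum_(r <- h) (r.1 != (w, w))%:R :> R.
  rewrite -sum1_size natr_sum -sumrB; apply: eq_bigr => r _.
  by case: eqP => _; rewrite ?subrr ?subr0.
have N_le h : N h <= (size h)%:R.
  by rewrite -subr_ge0 size_N; apply: sumr_ge0 => r _.
(* Each round off [(w, w)] costs at least [c] under [M]. *)
have EN : expectation_hist M A T N >= T%:R - expected_regret M w A T / c.
  have : c * (T%:R - expectation_hist M A T N) <= expected_regret M w A T.
    rewrite -[T%:R](expectation_hist_cst M A T) -mulN1r -expectation_histZ.
    rewrite -expectation_histD -expectation_histZ expected_regretE.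
    apply: le_expectation_hist => // h hT; rewrite mulN1r -hT size_N mulr_sumr.
    apply: ler_sum => r _; have [_|rw] := eqVneq r.1 (w, w).
      by rewrite mulr0 round_regret_ge0.
    by rewrite mulr1 cP.
  by rewrite mulrC -ler_pdivlMr//; lra.
(* Under [M'] a round on [(w, w)] costs exactly [e], the gap between [i] and [w]. *)
have EN' : expectation_hist M' A T N <= expected_regret M' i A T / e.
  rewrite ler_pdivlMr// mulrC -expectation_histZ expected_regretE.
  apply: le_expectation_hist => // h hT; rewrite mulr_sumr; apply: ler_sum => r _.
  have [->|_] := eqVneq r.1 (w, w); last by rewrite mulr0 round_regret_ge0.
  have [_ Mc _] := HM; have wi : w != i by rewrite eq_sym.
  have Miw : M i w <= 2^-1 by rewrite (Mc i w); have := Mw i iw; lra.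
  by rewrite mulr1 /round_regret/= /gap mxE eqxx wi Miw/=; lra.
(* The chord bound leaves [1] plus a multiple of the mean of [N], and [HT] is what makes that second
   term at most [1]. *)
have HY : expectation_hist M' A T (expR \o (fun h => l * (N h / T%:R))) <= 2.
  apply: (@le_trans _ _
      (expectation_hist M' A T (fun h => 1 + expR l / T%:R * N h))).
    apply: le_expectation_hist => // h hT /=.
    have y0 : 0 <= N h / T%:R by rewrite divr_ge0// ltW.
    have y1 : N h / T%:R <= 1 by rewrite ler_pdivrMr// mul1r -hT.
    apply: le_trans (@expR_chord _ l (N h / T%:R) _) _; first by rewrite y0.
    rewrite lerD2l mulrBr mulr1 mulrAC mulrC -mulrA; lra.
  rewrite expectation_histD expectation_hist_cst expectation_histZ.
  suff : expR l / T%:R * expectation_hist M' A T N <= 1 by lra.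
  apply: le_trans (ler_wpM2l _ EN') _; first by rewrite divr_ge0 ?expR_ge0// ltW.
  by rewrite mulrACA -invfM ler_pdivrMr ?mulr_gt0// mul1r mulrC [T%:R * e]mulrC.
have ac a b : M' a b = 0 -> M a b = 0 by exact: promote_abs_cont.
have := change_of_measure HM HM' ac HY.
apply: le_trans; rewrite lerD2r expectation_histZ; apply: ler_wpM2l => //.
under eq_expectation_hist do rewrite mulrC.
rewrite expectation_histZ [leRHS]mulrC ler_pdivlMr//.
by move: EN; rewrite invfM mulrBl mul1r -!mulrA mulVf ?gt_eqF// mulr1.
Qed.

End RegretLowerBound.

(** * Limits inferior and growth rates *)

Lemma limn_einf_ge {R : realType} (u : nat -> R) (c : R) :
  (forall eta, 0 < eta -> \forall T \near \oo, c - eta <= u T) ->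
  (c%:E <= limn_einf (fun T => (u T)%:E))%E.
Proof.
move=> cu; apply/lee_subgt0Pr => eta eta0.
(* The limit inferior unfolds to minus an infimum, over neighbourhoods of infinity, of suprema of
   [- u]; the set where [c - eta <= u T] is one such neighbourhood. *)
rewrite /limn_einf leeNr /limn_esup /limf_esup.
apply: (@le_trans _ _ (ereal_sup
    [set (- (u T)%:E)%E | T in [set T | c - eta <= u T]])).
  apply: ereal_inf_lbound => /=; exists [set T | c - eta <= u T] => //.
  exact: cu.
apply: ge_ereal_sup => _ [T /= cT <-].
by rewrite lee_fin lerN2.
Qed.

Lemma littleo_powR {R : realType} (f : nat -> R) (a c : R) : 0 < c ->
  (f : nat -> R^o) =o_\oo (fun T => T%:R `^ a : R^o) ->
  \forall T \near \oo, f T <= c * T%:R `^ a.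
Proof.
move=> c0 /eqoP/(_ c c0); apply: filterS => T /=.
by rewrite (ger0_norm (powR_ge0 _ _)); apply: le_trans; exact: ler_norm.
Qed.

Lemma ln_nat_near_ge {R : realType} (x : R) :
  \forall T \near \oo, x <= ln (T%:R : R).
Proof.
near=> T; have xT : expR x <= T%:R by near: T; exact: nbhs_infty_ger.
by rewrite -[x]expRK ler_ln ?posrE ?expR_gt0// (lt_le_trans _ xT) ?expR_gt0.
Unshelve. all: by end_near. Qed.

(** * Asymptotic regret bound for a model closed under promotion *)

Section Asymptotics.
Context {R : realType} {K : nat}.
Context (model : set 'M[R]_K) (M : 'M[R]_K) (w : 'I_K) (A : algorithm R K).
Context (modelM : model M) (HM : preference_matrix M).
Context (Mw : condorcet_winner M w) (HA : strongly_consistent model A).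
Context (model_promote : forall i e, 0 < e < 2^-1 -> model (promote M i e)).

Lemma information_near (i : 'I_K) (e a : R) :
  i != w -> 0 < e < 2^-1 -> 0 < a < 1 ->
  \forall T \near \oo,
    (1 - 3 * a) * ln T%:R <=
    expectation_hist M A T (fun h => \sum_(r <- h)
      bernoulli_kl (M r.1.1 r.1.2) (promote M i e r.1.1 r.1.2)).
Proof.
move=> iw e01 /andP[a0 a1]; have /andP[e0 e1] := e01.
have [c c0 cP] := round_regret_lb HM Mw.
have ca0 : 0 < c * a by rewrite mulr_gt0.
have := littleo_powR ca0 (HA modelM Mw ltr01).
have Mi : condorcet_winner (promote M i e) i by exact: promote_winner.
have := littleo_powR e0 (HA (model_promote i e01) Mi a0).
move=> H1 H2; near=> T.
have T0 : (0 < T)%N by near: T; exact: nbhs_infty_gt.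
have T0' : 0 < T%:R :> R by rewrite ltr0n.
have lnT : ln 2 / a <= ln T%:R by near: T; exact: ln_nat_near_ge.
have lnT1 : 0 <= ln T%:R :> R by rewrite ln_ge0// ler1n.
have XT : expected_regret M w A T <= c * a * T%:R `^ 1 by near: T.
have XT' : expected_regret (promote M i e) i A T <= e * T%:R `^ a by near: T.
have a1' : 0 <= 1 - a by lra.
(* With [l = (1 - a) ln T], a regret of at most [e T^a] under the promoted matrix meets the
   requirement. The losses [X <= a] and [ln 2 <= a ln T] then leave the factor
   [(1 - a)^2 - a >= 1 - 3 a]. *)
have := @information_lower_bound _ _ M w i A T e c ((1 - a) * ln T%:R) HM Mw iw
  e01 c0 cP T0 (mulr_ge0 a1' lnT1).
have -> : expR ((1 - a) * ln T%:R) = T%:R `^ (1 - a).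
  by rewrite /powR gt_eqF.
have XTe : expected_regret (promote M i e) i A T * T%:R `^ (1 - a) <= e * T%:R.
  apply: le_trans (ler_wpM2r (powR_ge0 _ _) XT') _.
  by rewrite -mulrA -powRD ?subrKC ?powRr1 ?(ltW T0')// gt_eqF ?implybT.
move=> /(_ XTe); apply: le_trans.
have : expected_regret M w A T / (c * T%:R) <= a.
  rewrite ler_pdivrMr ?mulr_gt0// mulrA [a * c]mulrC.
  by move: XT; rewrite powRr1// ltW.
move: lnT; rewrite ler_pdivrMr//.
set X := expected_regret _ _ _ _ / _; set L := ln T%:R; set l2 := ln 2 => lnT Xa.
have : (1 - a) * L * (1 - a) <= (1 - a) * L * (1 - X).
  by apply: ler_wpM2l; [exact: mulr_ge0|lra].
have : 0 <= L * a * a by rewrite !mulr_ge0// ltW.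
by move=> ? ?; lra.
Unshelve. all: by end_near. Qed.

Lemma regret_near (m : 'I_K -> R) (eta : R) :
  (forall i, 0 <= m i) ->
  (forall i j, M i j < 2^-1 ->
     m i * bernoulli_kl (M i j) 2^-1 <= round_regret M w (i, j)) ->
  0 < eta ->
  \forall T \near \oo,
    \sum_(i | i != w) m i - eta <= expected_regret M w A T / ln T%:R.
Proof.
move=> m0 mkl eta0; set S := \sum_(i | _) m i.
have S0 : 0 <= S by exact: sumr_ge0.
have [c c0 cP] := round_regret_lb HM Mw.
(* Chosen so that [4 a S <= eta], which gives [(1 + a) (S - eta) <= (1 - 3 a) S] at the end. *)
pose a := eta / (4 * (S + eta)).
have Se0 : 0 < S + eta by exact: ltr_wpDl.
have a0 : 0 < a by rewrite divr_gt0// mulr_gt0.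
have aS : 4 * a * S <= eta.
  have -> : 4 * a * S = eta * (S / (S + eta)).
    by rewrite /a; field; rewrite gt_eqF.
  by rewrite ger_pMr// ler_pdivrMr// mul1r lerDl ltW.
have a1 : a < 1 by rewrite ltr_pdivrMr; lra.
clearbody a.
(* The perturbation error per unit of weight: its total [d * S] is at most [a * c], hence at most
   [a] times the regret of any round off [(w, w)]. *)
pose d := a * c / (S + 1).
have ac0 : 0 < a * c by exact: mulr_gt0.
have d0 : 0 < d by apply: divr_gt0 => //; lra.
have dS : d * S <= a * c.
  rewrite /d mulrAC ler_pdivrMr; last lra.
  by rewrite ler_pM2l//; lra.
(* The solution of [- ln (1 - 2 * e) = d]. *)
pose e := (1 - expR (- d)) / 2.
have e01 : 0 < e < 2^-1.
  have := expR_gt0 (- d); have : expR (- d) < 1 by rewrite expR_lt1; lra.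
  by rewrite /e; lra.
have lne : - ln (1 - 2 * e) = d.
  rewrite (_ : 1 - 2 * e = expR (- d)) ?expRK ?opprK//.
  by rewrite /e; lra.
have HI : \forall T \near \oo, forall i, i != w ->
    (1 - 3 * a) * ln T%:R <=
    expectation_hist M A T (fun h => \sum_(r <- h)
      bernoulli_kl (M r.1.1 r.1.2) (promote M i e r.1.1 r.1.2)).
  apply: filter_forall => i; have [_|iw] := eqVneq i w.
    by apply: nearW.
  have a01 : 0 < a < 1 by rewrite a0.
  by have := information_near iw e01 a01; apply: filterS => T H _.
near=> T.
have L0 : 0 < ln T%:R :> R.
  by apply: (@lt_le_trans _ _ 1) => //; near: T; exact: ln_nat_near_ge.
have HT : forall i, i != w -> (1 - 3 * a) * ln T%:R <=
    expectation_hist M A T (fun h => \sum_(r <- h)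
      bernoulli_kl (M r.1.1 r.1.2) (promote M i e r.1.1 r.1.2)) by near: T.
rewrite ler_pdivlMr//.
have : S * ((1 - 3 * a) * ln T%:R) <= (1 + a) * expected_regret M w A T.
  rewrite /S mulr_suml.
  apply: le_trans (ler_sum _ (fun i iw => ler_wpM2l (m0 i) (HT i iw))) _.
  under eq_bigr do rewrite -expectation_histZ.
  rewrite -expectation_hist_sum expected_regretE -expectation_histZ.
  apply: le_expectation_hist => // h _.
  under eq_bigr do rewrite mulr_sumr.
  rewrite exchange_big mulr_sumr; apply: ler_sum => -[p x] _ /=.
  have [->|pw] := eqVneq p (w, w).
    rewrite big1 => [|i iw]; last by rewrite /= promote_kl_winner ?mulr0.
    by rewrite mulr_ge0 ?round_regret_ge0//; lra.
  apply: le_trans (promote_kl_le_regret p HM Mw e01 m0 mkl) _.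
  rewrite -mulNr lne mulrDl mul1r lerD2l; apply: (le_trans dS).
  by rewrite ler_pM2l// cP.
move: L0; set L := ln T%:R; set X := expected_regret _ _ _ _ => L0 SX.
have : (1 + a) * ((S - eta) * L) <= (1 + a) * X.
  apply: le_trans SX; rewrite !mulrA; apply: ler_wpM2r; first exact: ltW.
  by have : 0 <= a * eta; [rewrite mulr_ge0 ?ltW|lra].
by rewrite ler_pM2l//; lra.
Unshelve. all: by end_near. Qed.

Lemma regret_constant_le :
  (regret_constant M w <=
    limn_einf (fun T : nat => (expected_regret M w A T / ln T%:R)%:E))%E.
Proof.
have [M01 Mc Mh] := HM.
pose v i j := (gap M w i + gap M w j) / (2 * bernoulli_kl (M i j) 2^-1).
have kl0 i j : 0 <= bernoulli_kl (M i j) 2^-1.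
  by apply: bernoulli_kl_ge0 => //; lra.
have v0 i j : 0 <= v i j.
  apply: divr_ge0; first by apply: addr_ge0; exact: gap_ge0.
  by apply: mulr_ge0 => //; exact: kl0.
(* A real-valued form of the extended minimum. For [i != w] the starting value [v i w] is itself in
   the range, because [w] is a superior of [i]. *)
pose m i := \big[Order.min/v i w]_(j in superiors M i) v i j.
have m0 i : 0 <= m i by rewrite le_bigmin.
have mkl i j : M i j < 2^-1 ->
    m i * bernoulli_kl (M i j) 2^-1 <= round_regret M w (i, j).
  move=> Mij; have : m i <= v i j by apply: bigmin_le_cond; rewrite inE.
  have := round_regret_ge0 (i, j) HM Mw.
  (* If the divergence is [0], the quotient [v i j] has no meaning, but the claim reduces to
     nonnegativity of the regret. *)
  have := kl0 i j; rewrite le0r => /predU1P[->|klij0]; first by rewrite mulr0.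
  move=> _ /(ler_wpM2r (ltW klij0)) /le_trans; apply.
  rewrite (_ : round_regret M w (i, j) = v i j * bernoulli_kl (M i j) 2^-1)//.
  by rewrite /v /round_regret/=; field; rewrite gt_eqF.
apply: (@le_trans _ _ (\sum_(i | i != w) m i)%:E).
  rewrite -sumEFin; apply: lee_sum => i iw.
  have iwS : w \in superiors M i.
    by rewrite inE (Mc i w); have := Mw iw; lra.
  have [j jS ->] : exists2 j, j \in superiors M i & m i = v i j.
    rewrite /m; elim/big_ind: _ => [|x y [j jS ->] [k kS ->]|j jS].
    - by exists w.
    - by rewrite /Order.min; case: ifP => _; [exists j|exists k].
    - by exists j.
  exact: bigmin_le_cond.
apply: limn_einf_ge => eta eta0; exact: regret_near.
Qed.

End Asymptotics.

Theorem theorem2 (R : realType) (K : nat) (hK : (2 <= K)%N) :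
  (forall (M : 'M[R]_K) (w : 'I_K) (A : algorithm R K),
     condorcet_model M -> condorcet_winner M w ->
     strongly_consistent (@condorcet_model R K) A ->
     (regret_constant M w <=
        limn_einf (fun T : nat => (expected_regret M w A T / ln T%:R)%:E))%E)
  /\
  (forall (M : 'M[R]_K) (w : 'I_K) (A : algorithm R K),
     order_model M -> condorcet_winner M w ->
     strongly_consistent (@order_model R K) A ->
     (regret_constant M w <=
        limn_einf (fun T : nat => (expected_regret M w A T / ln T%:R)%:E))%E).
Proof.
(* Both parts are instances of the same bound; what remains is that each model is closed under
   promotion. *)
split=> M w A HM Mw HA; apply: (regret_constant_le HM _ Mw HA).
- by case: HM.
- move=> i e e01; split; first by apply: promote_preference => //; case: HM.
  by exists i; apply: promote_winner; case/andP: e01.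
- by case: HM.
- by move=> i e e01; exact: promote_order.
Qed.
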